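(* If $P$ is a polygonal domain that is a Lip-1 domain and no two sides of $P$ are orthogonal, then there exists a path $P_t$, $t\in[0,1]$, of polygons such that for each $t$ no two sides of $P_t$ are orthogonal, $P_1=P$, and $P_0$ is an obtuse triangle.
   Context: A Lip-$K$ domain is a planar domain of the form $\{(x,y): f_-(x)<y<f_+(x)\}$ where $f_\pm:[-b,b]\to\mathbb R$ are Lipschitz functions with Lipschitz constant at most $K$, with $f_+(\pm b)=f_-(\pm b)$ and $f_-(x)<f_+(x)$ for $x\in(-b,b)$. A path of polygons is a continuous family of $n$-gons ($n$ fixed) whose vertices vary continuously and do not collide; the angle at a vertex is allowed to become equal to $\pi$, so that, for example, a triangle may be regarded as an $n$-gon by declaring some points on its sides to be vertices of angle $\pi$. *)

(* Defs.v *)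
From mathcomp Require Import all_boot all_order all_algebra.
From mathcomp Require Import all_classical all_reals all_analysis.
Export numFieldNormedType.Exports.

Set Implicit Arguments.
Unset Strict Implicit.
Unset Printing Implicit Defensive.

Import Order.TTheory GRing.Theory Num.Theory.

Local Open Scope classical_set_scope.
Local Open Scope ring_scope.

Section PlaneGeometry.
Variable R : realType.

Notation plane := (R * R)%type.

Definition vec (p q : plane) : plane := (q.1 - p.1, q.2 - p.2).

Definition dot (u w : plane) : R := u.1 * w.1 + u.2 * w.2.

Definition enorm (u : plane) : R := Num.sqrt (dot u u).

Definition segment (p q : plane) : set plane :=
  [set z | exists2 s : R, 0 <= s <= 1 &
           z = ((1 - s) * p.1 + s * q.1, (1 - s) * p.2 + s * q.2)].

(* The unoriented angle at [b] between the rays [ba] and [bc], in [0, pi]. *)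
Definition angle (a b c : plane) : R :=
  acos (dot (vec b a) (vec b c) / (enorm (vec b a) * enorm (vec b c))).

(* An n-gon is a cyclically indexed family of n vertices; side number i joins
   vertex i to vertex [ordS i] (i + 1 modulo n). *)
Definition side n (v : 'I_n -> plane) (i : 'I_n) : set plane :=
  segment (v i) (v (ordS i)).

Definition polygon_curve n (v : 'I_n -> plane) : set plane :=
  \bigcup_i side v i.

(* Distinct sides meet at most in an endpoint shared by consecutive sides.
   Three consecutive vertices may be collinear, provided the middle one lies
   between the others: this is a vertex of angle pi.  An angle 0 is excluded. *)
Definition simple_polygon n (v : 'I_n -> plane) : Prop :=
  [/\ (3 <= n)%N, injective v &
      forall (i j : 'I_n) (z : plane), i != j -> side v i z -> side v j z ->
        (j = ordS i /\ z = v j) \/ (i = ordS j /\ z = v i)].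

Definition no_orthogonal_sides n (v : 'I_n -> plane) : Prop :=
  forall i j : 'I_n, i != j ->
    dot (vec (v i) (v (ordS i))) (vec (v j) (v (ordS j))) != 0.

(* By the Jordan curve theorem the bounded component of the complement of the
   polygonal curve is the only D with these properties. *)
Definition polygonal_domain n (v : 'I_n -> plane) (D : set plane) : Prop :=
  simple_polygon v /\
  [/\ D !=set0, open D, connected D, bounded_set D &
      closure D `\` D° = polygon_curve v].

Definition lip_domain (K : R) (D : set plane) : Prop :=
  exists (b : R) (fm fp : R -> R),
    [/\ 0 < b,
        K.-lipschitz_(`[- b, b]) fm /\ K.-lipschitz_(`[- b, b]) fp,
        fp (- b) = fm (- b) /\ fp b = fm b,
        forall x, - b < x < b -> fm x < fp x &
        D = [set z | - b <= z.1 <= b /\ fm z.1 < z.2 < fp z.1]].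

Definition polygon_path n (P : R -> 'I_n -> plane) : Prop :=
  (forall t, 0 <= t <= 1 -> simple_polygon (P t)) /\
  (forall i, {within `[0, 1], continuous (fun t => P t i)}).

(* The n-gon [v] is an obtuse triangle whose corners are the vertices numbered
   [s 0], [s 1], [s 2]; the other vertices lie on its sides. *)
Definition obtuse_triangle n (v : 'I_n -> plane) : Prop :=
  exists s : 'I_3 -> 'I_n,
    let T := fun k => v (s k) in
    [/\ simple_polygon T, polygon_curve v = polygon_curve T &
        exists k, pi / 2 < angle (T (ord_pred k)) (T k) (T (ordS k))].

End PlaneGeometry.

(* Main.v *)
Require Import Defs.
From mathcomp Require Import all_boot all_order all_algebra.
From mathcomp Require Import all_classical all_reals all_analysis.
From mathcomp Require Import ring lra.

Set Implicit Arguments.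
Unset Strict Implicit.
Unset Printing Implicit Defensive.

Import Order.TTheory GRing.Theory Num.Theory.
Local Open Scope classical_set_scope.
Local Open Scope ring_scope.

(** The boundary of a Lip-1 domain is the union of the graphs of f_- and f_+
    over [-b, b].  A side of the polygon lies on one of the two graphs, because
    off the end points the graphs are disjoint closed sets; so no side is
    vertical and every side has slope in [-1, 1].  Among such slopes
    orthogonality means that one is 1 and the other -1, and it cannot occur for
    proper averages of such slopes with slopes in (-1, 1).

    This suggests to move every vertex along a vertical line, at constant
    speed, towards a triangle with base [-b, b] whose two other sides have slopes
    in (-1, 1): at times t < 1 all the slopes are then in (-1, 1).
    The triangle is chosen as follows.  As n >= 3, some vertex v_k has its
    abscissa a in (-b, b).  If it lies on the graph of f_+, the graph of f_- is
    deformed into the segment [-b, b], and that of f_+ into a tent with peak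
    above a; if it lies on the graph of f_-, the roles are exchanged and the
    tent points down.  To treat both cases at once, f1 denotes the function
    whose graph contains v_k, f0 the other one, and sg = 1 or -1 the sign of
    f1 - f0.  The peak has height (b^2 - a^2) / (2 b), so the slopes of the tent
    have absolute values (b - a) / (2 b) and (b + a) / (2 b), which are less
    than 1, and hence the angle at the peak is obtuse.

    Simplicity is inherited from the given polygon: the motion extends to a map
    [deform] of the whole boundary curve, which preserves abscissas.  It is injective
    ([deform_inj]), since a convex combination of the gap f1 - f0 and of the
    tent does not vanish on (-b, b); and it maps sides affinely onto sides
    ([deform_bary]), since no side of the graph of f1 passes strictly over the
    break point a of the tent, v_k being a vertex there ([side_peak]).  The
    incidences between sides are therefore preserved. *)

(** * The boundary of a Lip-1 domain *)

Section Boundary.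
Variable R : realType.
Implicit Types (b x y e : R) (z : R * R).

Lemma itv_oo_or_end b x : - b <= x <= b -> - b < x < b \/ (x = - b \/ x = b).
Proof.
move=> /andP[]; rewrite le_eqVlt => /predU1P[->|h1]; first by right; left.
rewrite le_eqVlt => /predU1P[->|h2]; first by right; right.
by left; rewrite h1 h2.
Qed.

Definition lip1 b (f : R -> R) :=
  forall x y, - b <= x <= b -> - b <= y <= b -> `|f x - f y| <= `|x - y|.

Lemma lipschitz_lip1 b f : 1.-lipschitz_(`[- b, b]) f -> lip1 b f.
Proof.
move=> lf x y xb yb; have := lf (x, y); rewrite /= mul1r; apply.
by split; rewrite /= in_itv.
Qed.

Definition two_graphs b (f0 f1 : R -> R) : set (R * R) :=
  [set z | - b <= z.1 <= b /\ (z.2 = f0 z.1 \/ z.2 = f1 z.1)].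

Lemma closure_planeP (D : set (R * R)) z : closure D z <->
  forall e, 0 < e -> exists2 w, D w & `|z.1 - w.1| < e /\ `|z.2 - w.2| < e.
Proof.
split=> [clD e e0|H B /nbhs_ballP[e /= e0 eB]].
  have /clD[w [Dw [w1 w2]]] : nbhs z (ball z e) by apply: nbhsx_ballx.
  by exists w.
have [w Dw [w1 w2]] := H _ e0.
by exists w; split => //; apply: eB.
Qed.

(** The strict inequalities between the graphs become weak in the closure, by
    continuity.  Conversely a point of a graph is approached from inside the
    domain: first contract its abscissa towards 0, which leaves the end points
    where the domain has no width, then step off the graph into the gap. *)
Lemma closure_lip_domain b (fm fp : R -> R) : 0 < b ->
  lip1 b fm -> lip1 b fp -> fp (- b) = fm (- b) -> fp b = fm b ->
  (forall x, - b < x < b -> fm x < fp x) ->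
  let D := [set z | - b <= z.1 <= b /\ fm z.1 < z.2 < fp z.1] in
  closure D `\` D = two_graphs b fm fp.
Proof.
move=> b0 lm lp eN eP gap D; apply/seteqP; split=> [z [cl nD]|z [zb zf]].
  move/closure_planeP: cl => cl.
  have zb : - b <= z.1 <= b.
    apply/andP; split; rewrite leNgt; apply/negP => zb.
      have [|w [wb _]] := cl (- b - z.1); first lra.
      rewrite !ltr_norml; lra.
    have [|w [wb _]] := cl (z.1 - b); first lra.
    rewrite !ltr_norml; lra.
  split=> //.
  have zm : fm z.1 <= z.2.
    rewrite leNgt; apply/negP => zm.
    have [|w [wb wf]] := cl ((fm z.1 - z.2) / 2); first lra.
    have := lm _ _ zb wb; rewrite ler_norml !ltr_norml => + [w1 w2].
    have : `|z.1 - w.1| < (fm z.1 - z.2) / 2 by rewrite ltr_norml.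
    lra.
  have zp : z.2 <= fp z.1.
    rewrite leNgt; apply/negP => zp.
    have [|w [wb wf]] := cl ((z.2 - fp z.1) / 2); first lra.
    have := lp _ _ zb wb; rewrite ler_norml !ltr_norml => + [w1 w2].
    have : `|z.1 - w.1| < (z.2 - fp z.1) / 2 by rewrite ltr_norml.
    lra.
  have [->|zm'] := eqVneq z.2 (fm z.1); first by left.
  have [->|zp'] := eqVneq z.2 (fp z.1); first by right.
  by case: nD; split=> //; rewrite !lt_neqAle eq_sym zm' zm zp' zp.
split; last by move=> [_]; case: zf => ->; rewrite ltxx ?andbF.
apply/closure_planeP => e e0.
(* The contraction by 1 - d moves the abscissa by at most d b <= e / 4. *)
pose d := Num.min (1 / 2) (e / (4 * b)).
have d0 : 0 < d by rewrite lt_min; apply/andP; split; [lra|apply: divr_gt0; lra].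
have d1 : d <= 1 / 2 by rewrite ge_min lexx.
have d2 : d * b <= e / 4.
  rewrite -ler_pdivlMr//; rewrite ge_min; apply/orP; right.
  by rewrite -mulrA -invfM.
pose x := (1 - d) * z.1.
have xb : - b < x < b by rewrite /x; apply/andP; split; nra.
have xb' : - b <= x <= b by lra.
have xz : `|z.1 - x| < e / 2.
  have -> : z.1 - x = d * z.1 by rewrite /x; ring.
  rewrite normrM (gtr0_norm d0); have : `|z.1| <= b by rewrite ler_norml.
  nra.
have gx := gap x xb.
pose y := Num.min (e / 2) ((fp x - fm x) / 2).
have y0 : 0 < y by rewrite lt_min; apply/andP; split; lra.
have y1 : y <= e / 2 by rewrite ge_min lexx.
have y2 : y <= (fp x - fm x) / 2 by rewrite ge_min lexx orbT.
case: zf => zf.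
  exists (x, fm x + y); first by split=> //=; lra.
  rewrite /= zf; split; first lra.
  by have := lm _ _ zb xb'; rewrite ler_norml ltr_norml; lra.
exists (x, fp x - y); first by split=> //=; lra.
rewrite /= zf; split; first lra.
by have := lp _ _ zb xb'; rewrite ler_norml ltr_norml; lra.
Qed.

End Boundary.

(** * Segments on a union of two graphs *)

Section TwoGraphs.
Variable R : realType.

Lemma lip_within_continuous (u w M : R) (h : R -> R) : 0 <= M ->
  (forall x y, u <= x <= w -> u <= y <= w -> `|h x - h y| <= M * `|x - y|) ->
  {within `[u, w], continuous h}.
Proof.
move=> M0 lh; apply/subspace_continuousP => x /= ; rewrite in_itv /= => xuw.
apply/cvgrPdist_lt => e e0.
apply/nbhs_ballP; exists (e / (M + 1)) => /=; first by apply: divr_gt0 => //; lra.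
move=> y; rewrite /ball /= => xy; rewrite in_itv /= => yuw.
apply: le_lt_trans (lh _ _ xuw yuw) _.
move: xy; rewrite ltr_pdivlMr; last lra.
have := normr_ge0 (x - y); nra.
Qed.

Definition bary (p q : R * R) (s : R) : R * R :=
  ((1 - s) * p.1 + s * q.1, (1 - s) * p.2 + s * q.2).

Lemma bary0 (p q : R * R) : bary p q 0 = p.
Proof. by rewrite /bary subr0 !mul1r !mul0r !addr0 -surjective_pairing. Qed.

Lemma bary1 (p q : R * R) : bary p q 1 = q.
Proof. by rewrite /bary subrr !mul1r !mul0r !add0r -surjective_pairing. Qed.

Section Graphs.
Variables (b sg : R) (f0 f1 : R -> R).
Hypotheses (sg1 : `|sg| = 1) (lip1_f0 : lip1 b f0) (lip1_f1 : lip1 b f1)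
  (eqL : f1 (- b) = f0 (- b)) (eqR : f1 b = f0 b)
  (gap : forall x, - b < x < b -> 0 < sg * (f1 x - f0 x)).

Lemma two_graphs_interior (z : R * R) : two_graphs b f0 f1 z ->
  f1 z.1 <> f0 z.1 -> - b < z.1 < b.
Proof.
move=> [zb _] ne; have [//|ze] := itv_oo_or_end zb.
by case: ne; case: ze => ->.
Qed.

Lemma two_graphs_end (z : R * R) : two_graphs b f0 f1 z -> f0 z.1 = f1 z.1 ->
  z.1 = - b \/ z.1 = b.
Proof.
move=> [zb _] e; have [zi|//] := itv_oo_or_end zb.
by have := gap zi; rewrite e subrr mulr0 ltxx.
Qed.

(** Along the segment, the signed height above the mean of f0 and f1 is
    continuous, positive at interior points of the graph of f1, negative at those
    of f0, and nonzero between two such points; so both kinds cannot occur. *)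
Lemma segment_one_graph (p q : R * R) :
  (forall s, 0 <= s <= 1 -> two_graphs b f0 f1 (bary p q s)) ->
  (forall s, 0 <= s <= 1 -> (bary p q s).2 = f0 (bary p q s).1) \/
  (forall s, 0 <= s <= 1 -> (bary p q s).2 = f1 (bary p q s).1).
Proof.
move=> pq; set z := bary p q.
pose h s := sg * (2 * (z s).2 - f0 (z s).1 - f1 (z s).1).
pose M := 2 * `|q.2 - p.2| + 2 * `|q.1 - p.1|.
have lh x y : 0 <= x <= 1 -> 0 <= y <= 1 -> `|h x - h y| <= M * `|x - y|.
  move=> x01 y01; rewrite /h -mulrBr normrM sg1 mul1r.
  have [zx _] := pq x x01; have [zy _] := pq y y01.
  have e2 : (z x).2 - (z y).2 = (q.2 - p.2) * (x - y) by rewrite /z/=; ring.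
  have e1 : (z x).1 - (z y).1 = (q.1 - p.1) * (x - y) by rewrite /z/=; ring.
  have := lip1_f0 zx zy; have := lip1_f1 zx zy.
  rewrite -/(z x) -/(z y) e1 normrM => l1 l0.
  have -> : M * `|x - y| = 2 * (`|q.2 - p.2| * `|x - y|) +
      2 * (`|q.1 - p.1| * `|x - y|) by rewrite /M; ring.
  rewrite -!normrM -e2 -e1.
  have -> : 2 * (z x).2 - f0 (z x).1 - f1 (z x).1 -
     (2 * (z y).2 - f0 (z y).1 - f1 (z y).1) = 2 * ((z x).2 - (z y).2) -
     (f0 (z x).1 - f0 (z y).1) - (f1 (z x).1 - f1 (z y).1) by ring.
  move: l1 l0; rewrite -normrM -e1.
  set A := (z x).2 - _; set B := f0 _ - _; set C := f1 _ - _.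
  set E := (z x).1 - _ => l1 l0.
  have := ler_normB (2 * A - B) C; have := ler_normB (2 * A) B.
  rewrite normrM (ger0_norm (x := 2)) //; lra.
have M0 : 0 <= M by rewrite addr_ge0 // mulr_ge0.
have [?|/existsNP[s /not_implyP[s01 n0]]] :=
  pselect (forall s, 0 <= s <= 1 -> (z s).2 = f0 (z s).1); first by left.
right=> r r01; apply: contrapT => n1.
have zs : (z s).2 = f1 (z s).1 by have [_ []] := pq s s01.
have zr : (z r).2 = f0 (z r).1 by have [_ []] := pq r r01.
have inn x : 0 <= x <= 1 -> f1 (z x).1 <> f0 (z x).1 -> - b < (z x).1 < b.
  by move=> x01; apply: two_graphs_interior; apply: pq.
have zsb : - b < (z s).1 < b by apply: inn => //; rewrite -zs.
have zrb : - b < (z r).1 < b by apply: inn => //; rewrite -zr => /esym.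
have hs : 0 < h s.
  by have := gap zsb; rewrite /h zs; congr (_ < _); ring.
have hr : h r < 0.
  by have := gap zrb; rewrite -oppr_lt0 /h zr; congr (_ < _); ring.
have zero c : 0 <= c <= 1 -> - b < (z c).1 < b -> h c <> 0.
  move=> c01 /gap g hc; have [_] := pq c c01; rewrite -/(z c) => -[] e;
   move: hc; rewrite /h e; lra.
have ivt u w : 0 <= u -> w <= 1 -> u <= w -> - b < (z u).1 < b ->
   - b < (z w).1 < b -> Num.min (h u) (h w) <= 0 <= Num.max (h u) (h w) -> False.
  move=> u0 w1 uw zu zw m; have cont : {within `[u, w], continuous h}.
    by apply: (lip_within_continuous (M := M)) => // x y xu yw; apply: lh; lra.
  have [c] := IVT uw cont m.
  rewrite in_itv /= => cuw; apply: zero; first lra.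
  have [cu cw] : 0 <= c - u /\ 0 <= w - c by lra.
  move: zu zw; rewrite /z /=; have [pq1|/ltW pq1] := leP p.1 q.1.
    have qp : 0 <= q.1 - p.1 by lra.
    by have := mulr_ge0 cu qp; have := mulr_ge0 cw qp; lra.
  have qp : 0 <= p.1 - q.1 by lra.
  by have := mulr_ge0 cu qp; have := mulr_ge0 cw qp; lra.
have [sr|rs] := leP s r.
  apply: (ivt s r) => //; try lra.
  by rewrite ge_min le_max (ltW hr) (ltW hs) orbT.
apply: (ivt r s) => //; try lra.
by rewrite ge_min le_max (ltW hr) (ltW hs) orbT.
Qed.

End Graphs.
End TwoGraphs.

(** * Obtuse triangles *)

Section Triangles.
Variable R : realType.

(** The cosine of the angle is negative. The Cauchy-Schwarz inequality puts it
    in [-1, 1], where [acos] inverts the cosine. *)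
Lemma obtuse_angle (p q r : R * R) :
  dot (vec q p) (vec q r) < 0 -> pi / 2 < angle p q r.
Proof.
rewrite /angle; set u := vec q p; set w := vec q r => uw.
have duw : (dot u w) ^+ 2 <= dot u u * dot w w.
  rewrite -subr_ge0 /dot.
  have -> : (u.1 * u.1 + u.2 * u.2) * (w.1 * w.1 + w.2 * w.2)
     - (u.1 * w.1 + u.2 * w.2) ^+ 2 = (u.1 * w.2 - u.2 * w.1) ^+ 2 by ring.
  exact: sqr_ge0.
have nn (a : R * R) : 0 <= dot a a by rewrite addr_ge0 // -expr2 sqr_ge0.
have enormM : enorm u * enorm w = Num.sqrt (dot u u * dot w w) by rewrite sqrtrM.
have pos : 0 < dot u u * dot w w by apply: lt_le_trans duw; rewrite exprn_even_gt0 //= lt_eqF.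
set N := enorm u * enorm w; have N0 : 0 < N by rewrite /N enormM sqrtr_gt0.
have cs : `|dot u w| <= N.
  by rewrite /N enormM -sqrtr_sqr ler_wsqrtr.
set c := dot u w / N.
have c1 : -1 <= c <= 1.
  by rewrite -ler_norml /c normrM normfV (gtr0_norm N0) ler_pdivrMr // mul1r.
have c0 : c < 0 by rewrite /c pmulr_llt0 // invr_gt0.
have [a0 aK] := acos_def c1.
rewrite ltNge; apply/negP => ale.
have : 0 <= cos (acos c) by apply: cos_ge0_pihalf; have := pi_ge0 R; lra.
by rewrite aK leNgt c0.
Qed.

Lemma ord3P (i : 'I_3) : [\/ i = ord0, i = ordS ord0 | i = ordS (ordS ord0)].
Proof.
case: i => -[|[|[|//]]] p; [constructor 1|constructor 2|constructor 3];
exact: val_inj.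
Qed.

(** Any two sides of a triangle are consecutive, so it suffices that the side
    after side i meets it only in their common vertex.  A common point that is not
    this vertex would make the two sides parallel. *)
Lemma triangle_simple (T : 'I_3 -> R * R) :
  let cross (p q r : R * R) :=
    (q.1 - p.1) * (r.2 - p.2) - (q.2 - p.2) * (r.1 - p.1) in
  cross (T ord0) (T (ordS ord0)) (T (ordS (ordS ord0))) != 0 ->
  simple_polygon T.
Proof.
move=> cross cr0.
have T3 : ordS (ordS (ordS ord0)) = ord0 :> 'I_3 by apply: val_inj.
have cr i : cross (T i) (T (ordS i)) (T (ordS (ordS i))) != 0.
  by case: (ord3P i) => ->; rewrite ?T3 //; move: cr0; rewrite /cross;
    apply: contra_neq => <-; ring.
have meet i z : side T i z -> side T (ordS i) z -> z = T (ordS i).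
  move=> [s s01 ->] [r r01 [e1 e2]].
  have : (1 - s) * cross (T i) (T (ordS i)) (T (ordS (ordS i))) = 0.
    set A := T i in e1 e2 *; set B := T (ordS i) in e1 e2 *.
    set C := T (ordS (ordS i)) in e1 e2 *.
    have h1 : (1 - s) * (B.1 - A.1) = - r * (C.1 - B.1) by lra.
    have h2 : (1 - s) * (B.2 - A.2) = - r * (C.2 - B.2) by lra.
    have -> : (1 - s) * cross A B C = (1 - s) * (B.1 - A.1) * (C.2 - B.2) -
        (1 - s) * (B.2 - A.2) * (C.1 - B.1) by rewrite /cross; ring.
    by rewrite h1 h2; ring.
  move/eqP; rewrite mulf_eq0 (negbTE (cr i)) orbF subr_eq0 => /eqP <-.
  by rewrite subrr !mul0r !add0r !mul1r -surjective_pairing.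
have next (i j : 'I_3) : i != j -> j = ordS i \/ i = ordS j.
  by case: (ord3P i) (ord3P j) => -> [] -> //; rewrite ?T3; auto.
split=> //.
- move=> i j Tij; apply/eqP; apply: contraT => /next[] ij.
    by have := cr i; rewrite -ij -Tij /cross !subrr !mul0r subrr eqxx.
  by have := cr j; rewrite -ij Tij /cross !subrr !mul0r subrr eqxx.
- move=> i j z /next[] ij zi zj; [left|right]; split=> //; rewrite ij;
  apply: meet; by rewrite -?ij.
Qed.
End Triangles.

(** * The tent function *)

Section Tent.
Variable R : realType.
Implicit Types a b x y : R.

(** Linear from (-b, 0) to the peak (a, (b^2 - a^2) / (2 b)) and from there to
    (b, 0).  This height of the peak makes the slopes (b - a) / (2 b) and
    - (b + a) / (2 b), both less than 1 in absolute value for every a. *)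
Definition tent b a x := Num.min ((x + b) * (b - a)) ((b - x) * (b + a)) / (2 * b).

Lemma tent_left b a x : 0 < b -> x <= a -> tent b a x = (x + b) * ((b - a) / (2 * b)).
Proof.
move=> b0 xa; rewrite /tent min_l ?mulrA // -subr_ge0.
have -> : (b - x) * (b + a) - (x + b) * (b - a) = 2 * (b * (a - x)) by ring.
by rewrite !mulr_ge0 //; lra.
Qed.

Lemma tent_right b a x : 0 < b -> a <= x -> tent b a x = (b - x) * ((b + a) / (2 * b)).
Proof.
move=> b0 xa; rewrite /tent min_r ?mulrA // -subr_ge0.
have -> : (x + b) * (b - a) - (b - x) * (b + a) = 2 * (b * (x - a)) by ring.
by rewrite !mulr_ge0 //; lra.
Qed.

Lemma tent_slopes b a : 0 < b -> - b < a < b ->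
  0 < (b - a) / (2 * b) < 1 /\ 0 < (b + a) / (2 * b) < 1.
Proof.
move=> b0 ab; have b2 : 0 < 2 * b by lra.
by rewrite !ltr_pdivrMr // !divr_gt0 //; lra.
Qed.

Lemma tent_gt0 b a x : 0 < b -> - b < a < b -> - b < x < b -> 0 < tent b a x.
Proof.
move=> b0 ab xb; have [/andP[L _] /andP[Q _]] := tent_slopes b0 ab.
have [xa|/ltW xa] := leP x a; rewrite ?(tent_left b0 xa) ?(tent_right b0 xa);
  apply: mulr_gt0 => //; lra.
Qed.

Lemma tent_end b a x : 0 < b -> - b < a < b -> x = - b \/ x = b -> tent b a x = 0.
Proof.
move=> b0 ab; case=> ->; last by rewrite tent_right ?subrr ?mul0r //; lra.
by rewrite tent_left ?addNr ?mul0r //; lra.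
Qed.

Lemma tent_affine b a x y : 0 < b -> - b < a < b ->
  ~~ (x < a < y) -> ~~ (y < a < x) ->
  exists2 m, `|m| < 1 & forall s, 0 <= s <= 1 ->
    tent b a ((1 - s) * x + s * y) = tent b a x + m * (s * (y - x)).
Proof.
move=> b0 ab xy yx; have [L Q] := tent_slopes b0 ab.
have [[xa ya]|[xa ya]] : (x <= a /\ y <= a) \/ (a <= x /\ a <= y).
  move: xy yx; rewrite !negb_and -!leNgt => /orP[?|?] /orP[?|?]; try lra;
  by have [?|?] := leP x a; lra.
- exists ((b - a) / (2 * b)); first by rewrite ltr_norml; lra.
  move=> s s01; rewrite !tent_left //; [ring|nra].
- exists (- ((b + a) / (2 * b))); first by rewrite ltr_norml; lra.
  move=> s s01; rewrite !tent_right //; [ring|nra].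
Qed.
End Tent.

(** * The deformation of the boundary curve *)

Section Deformation.
Variables (R : realType) (n : nat) (v : 'I_n -> R * R).
Variables (b sg : R) (f0 f1 : R -> R) (k : 'I_n).
Hypotheses (b0 : 0 < b) (sg1 : `|sg| = 1) (lip1_f0 : lip1 b f0) (lip1_f1 : lip1 b f1)
  (eqL : f1 (- b) = f0 (- b)) (eqR : f1 b = f0 b)
  (gap : forall x, - b < x < b -> 0 < sg * (f1 x - f0 x)).
Hypotheses (simple_v : simple_polygon v)
  (curve_v : polygon_curve v = two_graphs b f0 f1)
  (ortho_v : no_orthogonal_sides v).
Let a := (v k).1.
Hypotheses (ab : - b < a < b) (vk : (v k).2 = f1 a).

Let C := two_graphs b f0 f1.

(** The ordinate at time 0 of the point z of the curve.  At the end points,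
    where the graphs of f0 and f1 meet, the two cases agree as the tent
    vanishes there. *)
Definition tent_height (z : R * R) :=
  if z.2 == f1 z.1 then sg * tent b a z.1 else 0.

Definition deform t (z : R * R) : R * R :=
  (z.1, (1 - t) * tent_height z + t * z.2).

Lemma tent_height_f1 z : z.2 = f1 z.1 -> tent_height z = sg * tent b a z.1.
Proof. by rewrite /tent_height => ->; rewrite eqxx. Qed.

Lemma tent_height_f0 z : C z -> z.2 = f0 z.1 -> tent_height z = 0.
Proof.
move=> Cz z0; rewrite /tent_height z0; case: eqP => // e.
by rewrite (tent_end b0 ab) ?mulr0 //; apply: (two_graphs_end gap Cz).
Qed.

Lemma sg_sq : sg * sg = 1.
Proof. by rewrite -expr2 -real_normK ?num_real // sg1 expr1n. Qed.

(** Points with the same abscissa can only merge if they come from different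
    graphs, and then their signed distance, a convex combination of the tent and
    of the gap between the graphs, is positive. *)
Lemma deform_inj t z w : 0 <= t <= 1 -> C z -> C w ->
  deform t z = deform t w -> z = w.
Proof.
move=> t01.
suff H (p q : R * R) : C p -> C q -> p.2 = f0 p.1 -> q.2 = f1 q.1 ->
    deform t p = deform t q -> p = q.
  move=> Cz Cw; have [_ [z0|z1]] := Cz; have [_ [w0|w1]] := Cw.
  - by move=> [e _]; rewrite [z]surjective_pairing [w]surjective_pairing z0 w0 e.
  - exact: H.
  - by move=> e; apply/esym/H.
  - by move=> [e _]; rewrite [z]surjective_pairing [w]surjective_pairing z1 w1 e.
move=> Cp Cq p0 q1 [e1 e2]; rewrite [p]surjective_pairing [q]surjective_pairing p0 q1 e1.
congr (_, _); have [//|ne] := eqVneq (f0 q.1) (f1 q.1).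
have qb : - b < q.1 < b.
  by apply: (two_graphs_interior eqL eqR Cq) => e; rewrite e eqxx in ne.
move: e2; rewrite (tent_height_f0 Cp p0) (tent_height_f1 q1) p0 q1 e1.
have := gap qb; have := tent_gt0 b0 ab qb.
set T := tent b a _; set G := f1 _; set F := f0 _ => T0 g e.
have : 0 = (1 - t) * T + t * (sg * (G - F)).
  have -> : (1 - t) * T = sg * ((1 - t) * (sg * T)).
    by rewrite -[LHS]mul1r -sg_sq; ring.
  have -> : (1 - t) * (sg * T) = t * F - t * G by move: e; rewrite mulr0 add0r; lra.
  by ring.
have [tT|tT] := leP t (1 / 2); first nra.
have : 0 < t * (sg * (G - F)) by rewrite mulr_gt0 //; lra.
have : 0 <= (1 - t) * T by rewrite mulr_ge0 // ; lra.
lra.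
Qed.

Lemma polygon_size : (3 <= n)%N. Proof. by case: simple_v. Qed.

Lemma ordS_neq (i : 'I_n) : i != ordS i.
Proof.
apply/eqP => /(congr1 val) /=; have := polygon_size; case: i => i /= ilt n3'.
have [e|ne] := eqVneq i.+1 n; first by rewrite e modnn => i0; move: n3'; rewrite -e i0.
rewrite modn_small; last by rewrite ltn_neqAle ne.
by move/eqP; rewrite -[X in X == _]addn0 -addn1 eqn_add2l.
Qed.

Lemma side_curve i z : side v i z -> C z.
Proof. by rewrite /C -curve_v => vz; exists i. Qed.

Lemma side_bary i s : 0 <= s <= 1 -> side v i (bary (v i) (v (ordS i)) s).
Proof. by move=> s01; exists s. Qed.

Lemma side_start i : side v i (v i).
Proof.
by exists 0; rewrite ?lexx ?ler01 // subr0 !mul1r !mul0r !addr0 -surjective_pairing.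
Qed.

Lemma vertex_curve i : C (v i).
Proof. exact: side_curve (side_start i). Qed.

(** The vertex v_j is also on side j, and two sides meet only in an end point
    of both. *)
Lemma side_vertex i j : side v i (v j) -> j = i \/ j = ordS i.
Proof.
move=> ij; have [|ne] := eqVneq j i; first by left.
have [_ _ /(_ i j (v j))] := simple_v; rewrite eq_sym => /(_ ne ij (side_start j)).
case=> -[e e']; [by right|left].
by case: simple_v => _ vi _; apply: vi.
Qed.

Lemma side_graph i : exists f, [/\ f = f0 \/ f = f1, lip1 b f &
  forall s, 0 <= s <= 1 -> (bary (v i) (v (ordS i)) s).2 = f (bary (v i) (v (ordS i)) s).1].
Proof.
have [|H|H] := segment_one_graph sg1 lip1_f0 lip1_f1 eqL eqR gap (p := v i) (q := v (ordS i)).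
- by move=> s s01; apply/side_curve/side_bary.
- by exists f0; split=> //; left.
- by exists f1; split=> //; right.
Qed.

Lemma side_nonvertical i : (v (ordS i)).1 - (v i).1 != 0.
Proof.
have [f [_ _ H]] := side_graph i.
have := H 0; rewrite lexx ler01 bary0 => /(_ isT) h0.
have := H 1; rewrite lexx ler01 bary1 => /(_ isT) h1.
rewrite subr_eq0; apply/eqP => e.
have [_ vi _] := simple_v; have /eqP := ordS_neq i; apply; apply: vi.
by rewrite [v i]surjective_pairing h0 -e -h1 -surjective_pairing.
Qed.

(** Otherwise the side would contain the vertex v_k = (a, f1 a) in its relative
    interior, which simplicity forbids. *)
Lemma side_peak i : (forall s, 0 <= s <= 1 ->
    (bary (v i) (v (ordS i)) s).2 = f1 (bary (v i) (v (ordS i)) s).1) ->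
  ~~ ((v i).1 < a < (v (ordS i)).1) /\ ~~ ((v (ordS i)).1 < a < (v i).1).
Proof.
move=> H; set p := v i in H *; set q := v (ordS i) in H *.
have key s : 0 <= s <= 1 -> (1 - s) * p.1 + s * q.1 = a -> a = p.1 \/ a = q.1.
  move=> s01 e; suff /side_vertex[ki|ki] : side v i (v k).
  - by left; rewrite /a ki.
  - by right; rewrite /a ki.
  exists s => //; rewrite -/p -/q [v k]surjective_pairing vk -/a -e; congr (_, _).
  by have /= -> := H s s01.
have dd := side_nonvertical i; rewrite -/p -/q in dd.
have S : (1 - (a - p.1) / (q.1 - p.1)) * p.1 + (a - p.1) / (q.1 - p.1) * q.1 = a.
  by field.
split; apply/negP => lt.
  have qp : 0 < q.1 - p.1 by lra.
  have [] := key _ _ S; [|lra|lra].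
  by rewrite ler_pdivlMr // ler_pdivrMr //; lra.
have qp : 0 < p.1 - q.1 by lra.
have [] := key _ _ S; [|lra|lra].
by rewrite -mulrNN -invrN !opprB ler_pdivlMr // ler_pdivrMr //; lra.
Qed.

(** The slopes m and m0 of the side at times 1 and 0.  That [tent_height] is
    affine along the side is what makes [deform] map it to a segment. *)
Lemma side_slopes i :
  let p := v i in let q := v (ordS i) in
  exists m m0, [/\ `|m| <= 1, `|m0| < 1,
    q.2 - p.2 = m * (q.1 - p.1) &
    forall s, 0 <= s <= 1 ->
      tent_height (bary p q s) = tent_height p + m0 * (s * (q.1 - p.1))].
Proof.
move=> p q; have [f [ff lf H]] := side_graph i.
have dx := side_nonvertical i; rewrite -/p -/q in dx H.
have h0 : p.2 = f p.1 by have := H 0; rewrite lexx ler01 bary0 => ->.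
have h1 : q.2 = f q.1 by have := H 1; rewrite lexx ler01 bary1 => ->.
have [pb _] := vertex_curve i; have [qb _] := vertex_curve (ordS i).
have [m0 m01 Hm0] : exists2 m0, `|m0| < 1 & forall s, 0 <= s <= 1 ->
    tent_height (bary p q s) = tent_height p + m0 * (s * (q.1 - p.1)).
  case: ff => ff; subst f.
    exists 0; first by rewrite normr0.
    move=> s s01; rewrite mul0r addr0 !tent_height_f0 //.
    - exact: vertex_curve.
    - exact/side_curve/side_bary.
    - exact: H.
  have [pk qk] := side_peak H.
  have [m m1 Hm] := tent_affine b0 ab pk qk.
  exists (sg * m); first by rewrite normrM sg1 mul1r.
  by move=> s s01; rewrite !tent_height_f1 //; [rewrite /= Hm //; ring|apply: H].
exists ((q.2 - p.2) / (q.1 - p.1)), m0; split=> //; last by rewrite divfK.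
rewrite normrM normfV ler_pdivrMr ?normr_gt0 // mul1r h0 h1.
exact: lf.
Qed.

Let P t i := deform t (v i).

Lemma deform_bary t i s : 0 <= s <= 1 ->
  deform t (bary (v i) (v (ordS i)) s) = bary (P t i) (P t (ordS i)) s.
Proof.
move=> s01; have [m [m0 [_ _ _ H]]] := side_slopes i.
have := H 1; rewrite lexx ler01 bary1 => /(_ isT) H1.
rewrite /deform H // /bary /P /deform /= H1; congr (_, _); ring.
Qed.

Lemma side_deform t i : side (P t) i = deform t @` side v i.
Proof.
apply/seteqP; split=> [z [s s01 ->]|_ [_ [s s01 ->] <-]].
  by exists (bary (v i) (v (ordS i)) s); [apply: side_bary|apply: deform_bary].
by exists s => //; rewrite -/(bary _ _ _) deform_bary.
Qed.

Lemma deform_simple t : 0 <= t <= 1 -> simple_polygon (P t).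
Proof.
move=> t01; have [_ vi vs] := simple_v; split; first exact: polygon_size.
  move=> i j e; apply/vi/(deform_inj t01) => //; exact: vertex_curve.
move=> i j z ij; rewrite !side_deform => -[p pi <-] [q qj e].
have qp : q = p by apply: (deform_inj t01) e; [apply: (side_curve qj)|apply: (side_curve pi)].
by case: (vs i j p ij pi); rewrite -?{1}qp // => -[-> ->]; [left|right].
Qed.

(** For t < 1 a side has slope (1 - t) m0 + t m, of absolute value less than 1,
    so the product of two slopes is not -1. *)
Lemma deform_no_orthogonal t : 0 <= t <= 1 -> no_orthogonal_sides (P t).
Proof.
move=> t01 i j ij.
have [->|t1] := eqVneq t 1.
  have := ortho_v ij; rewrite /dot /vec /P /deform /=.
  by rewrite !subrr !mul0r !add0r !mul1r.
have edge l : exists2 m, `|m| < 1 & vec (P t l) (P t (ordS l)) =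
    ((v (ordS l)).1 - (v l).1, m * ((v (ordS l)).1 - (v l).1)).
  have [m [m0 [m1 m01 e H]]] := side_slopes l.
  have := H 1; rewrite lexx ler01 bary1 => /(_ isT) H1.
  exists ((1 - t) * m0 + t * m).
    have lt1 : t < 1 by rewrite lt_neqAle t1; lra.
    move: m1 m01; rewrite ler_norml !ltr_norml => m1 m01; nra.
  rewrite /vec /P /deform /= H1; congr (_, _).
  by move/eqP: e; rewrite subr_eq => /eqP ->; ring.
have [m m1 ->] := edge i; have [w w1 ->] := edge j.
rewrite /dot /=; have di := side_nonvertical i; have dj := side_nonvertical j.
set x := _ - _ in di *; set y := _ - _ in dj *.
have -> : x * y + m * x * (w * y) = x * y * (1 + m * w) by ring.
rewrite !mulf_neq0 // gt_eqF //.
have : `|m * w| < 1 by rewrite normrM; have := normr_ge0 m; have := normr_ge0 w; nra.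
by rewrite ltr_norml; lra.
Qed.

Lemma deform_continuous i : {within `[0, 1], continuous (fun t => P t i)}.
Proof.
apply: continuous_subspaceT => t; rewrite /P /deform.
apply: (cvg_pair (G := nbhs _) (H := nbhs _)); first exact: cvg_cst.
apply: cvgD; last by apply: cvgMl; exact: cvg_id.
by apply: cvgMl; apply: cvgB; [exact: cvg_cst|exact: cvg_id].
Qed.

Lemma deform1 : P 1 = v.
Proof.
apply/funext => i; rewrite /P /deform subrr mul0r add0r mul1r.
by rewrite -surjective_pairing.
Qed.

(** The extreme point of the curve lies on some side; as the side is not
    vertical and stays between the lines of abscissa -b and b, it ends there. *)
Lemma end_vertex x : x = - b \/ x = b -> exists2 l, (v l).1 = x & P 0 l = (x, 0).
Proof.
have b0' := b0; have ab' := ab => xb.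
have xbb : - b <= x <= b by case: xb => ->; lra.
have : C (x, f1 x) by split=> //; right.
rewrite /C -curve_v => -[i _ [s s01 [/= e1 _]]].
have [l lx] : exists l, (v l).1 = x.
  have := side_nonvertical i; have [pb _] := vertex_curve i.
  have [qb _] := vertex_curve (ordS i).
  have [s0|s0] := eqVneq s 0; first by exists i; rewrite e1 s0; ring.
  have [s1|s1] := eqVneq s 1; first by exists (ordS i); rewrite e1 s1; ring.
  have s0' : 0 < s by rewrite lt_neqAle eq_sym s0; lra.
  have s1' : s < 1 by rewrite lt_neqAle s1; lra.
  move=> /eqP ne; exfalso; apply: ne; case: xb => xb; subst x; nra.
exists l => //; rewrite /P /deform subr0 mul1r mul0r addr0 lx; congr (_, _).
by rewrite /tent_height lx (tent_end b0 ab) // mulr0 if_same.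
Qed.

Lemma deform0_curve : polygon_curve (P 0) =
  [set z | - b <= z.1 <= b /\ (z.2 = 0 \/ z.2 = sg * tent b a z.1)].
Proof.
apply/seteqP; split=> [z [i _]|[x y] /= [xb yy]].
  rewrite side_deform => -[w /side_curve Cw <-]; rewrite /= subr0 mul1r mul0r addr0.
  have [wb [w0|w1]] := Cw; split=> //; first by left; exact: tent_height_f0.
  by right; exact: tent_height_f1.
pose w : R * R := (x, if y == 0 then f0 x else f1 x).
have : C w by split=> //=; case: ifP; [left|right].
rewrite /C -curve_v => -[i _ wi]; exists i => //; rewrite side_deform.
exists w => //; rewrite /deform subr0 mul1r mul0r addr0; congr (_, _).
rewrite /w; case: eqP yy => [-> _|ny [//|->]].
  by apply: tent_height_f0 => //; split=> //; left.
exact: tent_height_f1.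
Qed.

(** The corners are the two end vertices and v_k.  At the peak, of height H, the
    dot product of the sides is - (b^2 - a^2) + H^2 = H (H - 2 b) < 0. *)
Lemma deform_obtuse : obtuse_triangle (P 0).
Proof.
have b0' := b0; have ab' := ab.
have [l vl Pl] := end_vertex (or_introl erefl).
have [r vr Pr] := end_vertex (or_intror erefl).
pose H := (b + a) * ((b - a) / (2 * b)).
have H0 : 0 < H by rewrite mulr_gt0 ?divr_gt0 //; lra.
have H2 : H * (2 * b) = (b + a) * (b - a) by rewrite /H; field; lra.
have Pk : P 0 k = (a, sg * H).
  rewrite /P /deform subr0 mul1r mul0r addr0 tent_height_f1 // -/a.
  by rewrite tent_left // addrC.
pose c (j : 'I_3) := nth k [:: l; k; r] j; pose T j := P 0 (c j).
suff : [/\ simple_polygon T, polygon_curve (P 0) = polygon_curve T &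
    exists j, pi / 2 < angle (T (ord_pred j)) (T j) (T (ordS j))] by exists c.
have T0 : T ord0 = (- b, 0) by [].
have T1 : T (ordS ord0) = (a, sg * H) by [].
have T2 : T (ordS (ordS ord0)) = (b, 0) by [].
clearbody T.
have S3 : ordS (ordS (ordS ord0)) = ord0 :> 'I_3 by apply: val_inj.
split.
- apply: triangle_simple; rewrite T0 T1 T2 /=.
  have -> : (a - - b) * (0 - 0) - (sg * H - 0) * (b - - b) = - (sg * (H * (2 * b))) by ring.
  rewrite H2 oppr_eq0 !mulf_neq0 //; try by apply/eqP; lra.
  by rewrite -normr_eq0 sg1 oner_eq0.
- have bb : 2 * b != 0 by apply/eqP; lra.
  rewrite deform0_curve; apply/seteqP; split=> [[x y] /= [xb [->|->]]|z [i _ [s s01 ->]]].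
  + exists (ordS (ordS ord0)) => //; rewrite /side S3 T0 T2.
    exists ((b - x) / (2 * b)); last by congr (_, _) => /=; field; lra.
    by rewrite ler_pdivlMr ?ler_pdivrMr //; lra.
  + have [xa|/ltW xa] := leP x a.
      exists ord0 => //; rewrite /side T0 T1 tent_left //.
      exists ((x + b) / (a + b)).
        by rewrite ler_pdivlMr ?ler_pdivrMr //; lra.
      by rewrite /H; congr (_, _) => /=; field; lra.
    exists (ordS ord0) => //; rewrite /side T1 T2 tent_right //.
    exists ((x - a) / (b - a)).
      by rewrite ler_pdivlMr ?ler_pdivrMr //; lra.
    by rewrite /H; congr (_, _) => /=; field; lra.
  + rewrite /side; case: (ord3P i) => ->; rewrite ?S3 ?T0 ?T1 ?T2 /=.
    * split; first nra.
      right; rewrite tent_left //; last nra.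
      by rewrite /H; ring.
    * split; first nra.
      right; rewrite tent_right //; last nra.
      by rewrite /H; ring.
    * split; first nra.
      by left; ring.
- exists (ordS ord0); apply: obtuse_angle.
  have -> : ord_pred (ordS ord0) = ord0 :> 'I_3 by apply: val_inj.
  rewrite T0 T1 T2 /dot /vec /=.
  have -> : (- b - a) * (b - a) + (0 - sg * H) * (0 - sg * H) =
    - ((b + a) * (b - a)) + (sg * sg) * H ^+ 2 by ring.
  have Hb : H < 2 * b.
    have [/andP[m0 m1] _] := tent_slopes b0 ab.
    by rewrite /H; move: m0 m1; set m := _ / _ => m0 m1; nra.
  have Hb' : 0 < 2 * b - H by lra.
  rewrite sg_sq mul1r -H2.
  by have := mulr_gt0 H0 Hb'; nra.
Qed.
End Deformation.

(** * The path to an obtuse triangle *)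

(** Each of the abscissas -b and b is taken by at most one vertex, because the
    graphs meet there, and there are at least three vertices. *)
Lemma interior_vertex (R : realType) n (v : 'I_n -> R * R) b (f0 f1 : R -> R) :
  simple_polygon v -> (forall i, two_graphs b f0 f1 (v i)) ->
  f1 (- b) = f0 (- b) -> f1 b = f0 b -> exists k, - b < (v k).1 < b.
Proof.
move=> [n3 vi _] vc eL eR; apply: contrapT => /forallNP noint.
have tip i : (v i).1 = - b \/ (v i).1 = b.
  by have [vb _] := vc i; have [/(noint i)|] := itv_oo_or_end vb.
have same i j : (v i).1 = (v j).1 -> i = j.
  move=> e; apply: vi; rewrite [v i]surjective_pairing [v j]surjective_pairing.
  congr (_, _) => //; have [_] := vc i; have [_] := vc j; rewrite e.
  by case: (tip j) => ->; rewrite ?eL ?eR => -[] -> [] ->.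
pose i0 : 'I_n := Ordinal (leq_trans (isT : 0 < 3)%N n3).
pose i1 : 'I_n := Ordinal (leq_trans (isT : 1 < 3)%N n3).
pose i2 : 'I_n := Ordinal (leq_trans (isT : 2 < 3)%N n3).
have [] : [\/ i0 = i1, i0 = i2 | i1 = i2] => //.
case: (tip i0) (tip i1) (tip i2) => [] h0 [] h1 [] h2;
  by [constructor 1; apply: same; rewrite h0 h1|
      constructor 2; apply: same; rewrite h0 h2|
      constructor 3; apply: same; rewrite h1 h2].
Qed.

Theorem proposition7p7 (R : realType) (n : nat) (v : 'I_n -> R * R)
    (D : set (R * R)) :
  polygonal_domain v D -> lip_domain 1 D -> no_orthogonal_sides v ->
  exists P : R -> 'I_n -> R * R,
    [/\ polygon_path P,
        forall t, 0 <= t <= 1 -> no_orthogonal_sides (P t),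
        P 1 = v &
        obtuse_triangle (P 0)].
Proof.
move=> [sv [_ oD _ _ bD]] [b [fm [fp [b0 [/lipschitz_lip1 lm /lipschitz_lip1 lp]]]]].
move=> [eL eR] gap DE ov.
have cv : polygon_curve v = two_graphs b fm fp.
  rewrite -bD (proj1 (interior_id D) oD) DE.
  exact: closure_lip_domain.
(* The two graphs keep interchangeable roles here: v k may lie on either. *)
have flat f0 f1 sg k : `|sg| = 1 -> lip1 b f0 -> lip1 b f1 ->
    f1 (- b) = f0 (- b) -> f1 b = f0 b ->
    (forall x, - b < x < b -> 0 < sg * (f1 x - f0 x)) ->
    polygon_curve v = two_graphs b f0 f1 ->
    - b < (v k).1 < b -> (v k).2 = f1 (v k).1 ->
    exists P : R -> 'I_n -> R * R, [/\ polygon_path P,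
      forall t, 0 <= t <= 1 -> no_orthogonal_sides (P t), P 1 = v &
      obtuse_triangle (P 0)].
  move=> sg1 l0 l1 e1 e2 g c kb kf.
  exists (fun t i => deform v b sg f1 k t (v i)); split.
  - split; first by move=> t t01; apply: (deform_simple (f0 := f0)).
    by move=> i; apply: deform_continuous.
  - by move=> t t01; apply: (deform_no_orthogonal (f0 := f0)).
  - exact: deform1.
  - exact: (deform_obtuse (f0 := f0)).
have vc i : two_graphs b fm fp (v i).
  by rewrite -cv; exists i => //; exact: side_start.
have [k kb] := interior_vertex sv vc eL eR.
have [_ [kf|kf]] := vc k.
- apply: (flat fp fm (-1) k) => //.
  + by rewrite normrN1.
  + by move=> x /gap; lra.
  + by rewrite cv; apply/seteqP; split=> z [zb [|]]; split; auto.
- apply: (flat fm fp 1 k) => //.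
  + by rewrite normr1.
  + by move=> x /gap; lra.
Qed.
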